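(* Let $K$ be a field with a discrete valuation ring $O_v$, let $A$ be a filtered $K$-algebra with (exhaustive, separated) filtration $FA$, and let $\Lambda\subset A$ be an $O_v$-order with $\Lambda\cap K=O_v$ and $K\Lambda=A$. Put $F_n\Lambda=\Lambda\cap F_nA$, $A_v=\Lambda/m_v\Lambda$, $F^v_nA=m_v^{-n}\Lambda$ and $f^v_nG_F(A)=m_v^{-n}G_F(\Lambda)$ for $n\in\mathbb{Z}$. 1. If $G_F(\Lambda)$ is $G_F(A)$-finite, then the filtration $F^vA$ is separated. 2. Assume that $\Lambda$ is $FA$-finite. Then: (a) The filtrations $f^vG_F(A)$ and $F^vA$ are both separated. One has $G_{F^v}(A)=A_v[t,t^{-1}]$ (with $A_v=G_{F^v}(A)_0$ and $t$ a central variable of degree one). The restriction $\overline{F}A_v$ to $A_v=G_{F^v}(A)_0$ of the filtration $\overline{F}G_{F^v}(A)$ induced by $FA$ is given by $\overline{F}_nA_v=F_n\Lambda/m_vF_n\Lambda$, and this is an unramified reduction of $F_nA$, for every $n\in\mathbb{Z}$. Moreover the filtration $\overline{F}G_{F^v}(A)$ on $G_{F^v}(A)=A_v[t,t^{-1}]$ is given by $\overline{F}_nG_{F^v}(A)=(\overline{F}_nA_v)[t,t^{-1}]$, $n\in\mathbb{Z}$. (b) For every $d\in\mathbb{Z}$ the filtration $F^vA$ induces a good filtration in $F_dA$; that is, the filtration $\{F^v_nA\cap F_dA\}_{n\in\mathbb{Z}}$ of $F_dA$, viewed as a filtered module over $K$ with the filtration $f^vK$, is good.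
   Context: $O_v$ is a discrete valuation ring with field of fractions $K$, maximal ideal $m_v=(\pi)$ and residue field $k_v=O_v/m_v$. The valuation filtration $f^vK$ on $K$ is $f^v_nK=m_v^{-n}$, $n\in\mathbb{Z}$. A filtration $FA$ on an associative unital $K$-algebra $A$ is an ascending family $\{F_nA\}_{n\in\mathbb{Z}}$ of additive subgroups with $F_nA\,F_mA\subset F_{n+m}A$ and $K\subset F_0A$ (so each $F_nA$ is a $K$-subspace); it is exhaustive if $\bigcup_nF_nA=A$ and separated if $\bigcap_nF_nA=0$. $FA$ is assumed exhaustive and separated. The associated graded ring is $G_F(A)=\bigoplus_nF_nA/F_{n-1}A$. $\Lambda$ is a subring of $A$ with $\Lambda\cap K=O_v$, $K\Lambda=A$, filtered by $F_n\Lambda=\Lambda\cap F_nA$; $G_F(\Lambda)=\bigoplus_nF_n\Lambda/F_{n-1}\Lambda$ is viewed as a graded subring of $G_F(A)$. $F^vA$ is the exhaustive filtration $F^v_nA=m_v^{-n}\Lambda=\pi^{-n}\Lambda$, and $G_{F^v}(A)$ is its associated graded ring; $f^vG_F(A)$ is the filtration $f^v_nG_F(A)=m_v^{-n}G_F(\Lambda)$. The filtration $\overline{F}G_{F^v}(A)$ induced by $FA$ has as $\overline{F}_nG_{F^v}(A)$ the graded subgroup whose degree $j$ part is the image of $F_nA\cap F^v_jA$ in $F^v_jA/F^v_{j-1}A$. $\Lambda$ is called $FA$-finite if $F_d\Lambda=\Lambda\cap F_dA$ is a finitely generated $O_v$-module for all $d\in\mathbb{Z}$; $G_F(\Lambda)$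 is called $G_F(A)$-finite if $G_F(\Lambda)_d=F_d\Lambda/F_{d-1}\Lambda$ is a finitely generated $O_v$-module for all $d\in\mathbb{Z}$. For a finite dimensional $K$-vector space $V$, an $O_v$-lattice in $V$ is a finitely generated $O_v$-submodule $M\subset V$ with $\mathrm{rank}_{O_v}M=\dim_KV$; then $M/m_vM$ is called an unramified reduction of $V$; one has $\dim_{k_v}(M/m_vM)=\dim_KV$. A filtration $FM$ on a filtered module $M$ over a filtered ring $R$ (filtration $FR$) is good if there are $m_1,\dots,m_s\in M$ and $d_1,\dots,d_s\in\mathbb{Z}$ with $F_nM=\sum_{i=1}^sF_{n-d_i}R\cdot m_i$ for every $n\in\mathbb{Z}$. *)

(* Defs.v *)
From HB Require Import structures.
From mathcomp Require Import all_boot all_order all_algebra.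
From mathcomp Require Import generic_quotient ring_quotient.
From mathcomp Require Import finmap monalg.
From mathcomp Require Import boolp classical_sets.

Set Implicit Arguments.
Unset Strict Implicit.
Unset Printing Implicit Defensive.

Import Order.TTheory GRing.Theory Num.Theory.
Local Open Scope fset_scope.
Local Open Scope classical_set_scope.
Local Open Scope ring_scope.
Local Open Scope quotient_scope.

(* R[t,t^-1], t central.  The additive group is that of [monalg]; its ring    *)
(* structure only covers monoids without nontrivial units, hence not int.     *)

Definition laurent (R : pzRingType) : Type := {malg R[int]}.

HB.instance Definition _ (R : pzRingType) :=
  GRing.Zmodule.copy (laurent R) {malg R[int]}.

Section LaurentRing.
Variable R : pzRingType.
Implicit Types (f g h : laurent R) (i j n : int) (a b : R).

Definition lmono n a : laurent R := mkmalgU n a.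

Definition lmul f g : laurent R :=
  \sum_(i <- msupp f) \sum_(j <- msupp g) lmono (i + j) (f@_i * g@_j).

Lemma lmono0 n : lmono n 0 = 0. Proof. exact: monalgU0. Qed.

Lemma lmonoD n a b : lmono n (a + b) = lmono n a + lmono n b.
Proof. exact: monalgUD. Qed.

Lemma lmonoE f : f = \sum_(i <- msupp f) lmono i f@_i.
Proof. exact: monalgE. Qed.

Lemma lmulw (d1 d2 : {fset int}) f g :
  (msupp f `<=` d1)%fset -> (msupp g `<=` d2)%fset ->
  lmul f g = \sum_(i <- d1) \sum_(j <- d2) lmono (i + j) (f@_i * g@_j).
Proof.
move=> le1 le2; rewrite /lmul (big_fset_incl _ le1) /=.
  apply/eq_bigr => i _; apply/big_fset_incl => // j _ /mcoeff_outdom ->.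
  by rewrite mulr0 lmono0.
move=> i _ /mcoeff_outdom fi0.
by rewrite big1 // => j _; rewrite fi0 mul0r lmono0.
Qed.

Lemma lmulDl : left_distributive lmul +%R.
Proof.
move=> f g h.
rewrite (lmulw (msuppD_le f g) (fsubset_refl _)).
rewrite (lmulw (fsubsetUl (msupp f) (msupp g)) (fsubset_refl (msupp h))).
rewrite (lmulw (fsubsetUr (msupp f) (msupp g)) (fsubset_refl (msupp h))).
rewrite -big_split /=; apply/eq_bigr => i _.
rewrite -big_split /=; apply/eq_bigr => j _.
by rewrite (mcoeffD i f g) mulrDl lmonoD.
Qed.

Lemma lmulDr : right_distributive lmul +%R.
Proof.
move=> h f g.
rewrite (lmulw (fsubset_refl _) (msuppD_le f g)).
rewrite (lmulw (fsubset_refl (msupp h)) (fsubsetUl (msupp f) (msupp g))).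
rewrite (lmulw (fsubset_refl (msupp h)) (fsubsetUr (msupp f) (msupp g))).
rewrite -big_split /=; apply/eq_bigr => i _.
rewrite -big_split /=; apply/eq_bigr => j _.
by rewrite (mcoeffD j f g) mulrDr lmonoD.
Qed.

Lemma lmul0g : left_zero 0 lmul.
Proof. by move=> f; rewrite /lmul msupp0 big_seq_fset0. Qed.

Lemma lmulg0 : right_zero 0 lmul.
Proof.
by move=> f; rewrite /lmul big1 // => i _; rewrite msupp0 big_seq_fset0.
Qed.

Lemma lmul_mono i j a b : lmul (lmono i a) (lmono j b) = lmono (i + j) (a * b).
Proof. by rewrite (lmulw msuppU_le msuppU_le) !big_seq_fset1 !mcoeffUU. Qed.

Lemma lmulEl f g : lmul f g = \sum_(i <- msupp f) lmul (lmono i f@_i) g.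
Proof.
rewrite [in LHS](lmonoE f).
exact: (big_morph (lmul^~ g) (fun _ _ => lmulDl _ _ _) (lmul0g _)).
Qed.

Lemma lmulEr f g : lmul f g = \sum_(j <- msupp g) lmul f (lmono j g@_j).
Proof.
rewrite [in LHS](lmonoE g).
exact: (big_morph (lmul f) (fun _ _ => lmulDr _ _ _) (lmulg0 _)).
Qed.

Lemma lmul1g : left_id (lmono 0 1) lmul.
Proof.
move=> f; rewrite lmulEr [RHS]lmonoE; apply/eq_bigr => i _.
by rewrite lmul_mono add0r mul1r.
Qed.

Lemma lmulg1 : right_id (lmono 0 1) lmul.
Proof.
move=> f; rewrite lmulEl [RHS]lmonoE; apply/eq_bigr => i _.
by rewrite lmul_mono addr0 mulr1.
Qed.

Lemma lmulA : associative lmul.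
Proof.
move=> f g h.
rewrite [RHS](big_morph (lmul^~ h) (fun _ _ => lmulDl _ _ _) (lmul0g _)).
rewrite lmulEl; apply/eq_bigr => i _.
rewrite [LHS](big_morph (lmul _) (fun _ _ => lmulDr _ _ _) (lmulg0 _)).
rewrite [RHS](big_morph (lmul^~ h) (fun _ _ => lmulDl _ _ _) (lmul0g _)).
apply/eq_bigr => j _.
rewrite [LHS](big_morph (lmul _) (fun _ _ => lmulDr _ _ _) (lmulg0 _)).
by rewrite lmulEr; apply/eq_bigr => k _; rewrite !lmul_mono mulrA addrA.
Qed.

HB.instance Definition _ := GRing.Zmodule_isPzRing.Build (laurent R)
  lmulA lmul1g lmulg1 lmulDl lmulDr.

Lemma laurent_mulE f g :
  f * g = \sum_(i <- msupp f) \sum_(j <- msupp g) lmono (i + j) (f@_i * g@_j).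
Proof. by []. Qed.

Lemma lmonoM i j a b : lmono i a * lmono j b = lmono (i + j) (a * b).
Proof. exact: lmul_mono. Qed.

Lemma coef_lmono n a i : (lmono n a)@_i = if n == i then a else 0.
Proof. by rewrite mcoeffU mulrb. Qed.

End LaurentRing.

(* The ring S/I, for S a subring of R and I a two-sided ideal of S. *)

Record subquot_data (R : pzRingType) := SubquotData {
  sq_ring : set R;
  sq_ideal : set R;
  sq_ring1 : sq_ring 1;
  sq_ringB : forall x y, sq_ring x -> sq_ring y -> sq_ring (x - y);
  sq_ringM : forall x y, sq_ring x -> sq_ring y -> sq_ring (x * y);
  sq_idealS : sq_ideal `<=` sq_ring;
  sq_ideal0 : sq_ideal 0;
  sq_idealB : forall x y, sq_ideal x -> sq_ideal y -> sq_ideal (x - y);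
  sq_idealMl : forall x y, sq_ring x -> sq_ideal y -> sq_ideal (x * y);
  sq_idealMr : forall x y, sq_ideal x -> sq_ring y -> sq_ideal (x * y)
}.

Section Subquotient.
Variables (R : pzRingType) (D : subquot_data R).

Definition sq_ring_pred : {pred R} := fun x => x \in sq_ring D.

Lemma sq_ring_pred_subring : subring_closed sq_ring_pred.
Proof.
split=> [|x y|x y]; first exact/mem_set/sq_ring1.
- by move=> /set_mem Sx /set_mem Sy; apply/mem_set/sq_ringB.
- by move=> /set_mem Sx /set_mem Sy; apply/mem_set/sq_ringM.
Qed.

HB.instance Definition _ :=
  GRing.isSubringClosed.Build R sq_ring_pred sq_ring_pred_subring.

Record sq_sub := SqSub { sq_val : R; _ : sq_ring_pred sq_val }.

HB.instance Definition _ := [isSub for sq_val].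
HB.instance Definition _ := [Choice of sq_sub by <:].
HB.instance Definition _ := GRing.SubChoice_isSubPzRing.Build R
  sq_ring_pred sq_sub sq_ring_pred_subring.

Definition sq_ideal_pred : {pred sq_sub} := fun x => sq_val x \in sq_ideal D.

Lemma sq_ideal_pred_zmod : zmod_closed sq_ideal_pred.
Proof.
split=> [|x y]; first exact/mem_set/sq_ideal0.
by move=> /set_mem Ix /set_mem Iy; apply/mem_set/sq_idealB.
Qed.

HB.instance Definition _ :=
  GRing.isZmodClosed.Build sq_sub sq_ideal_pred sq_ideal_pred_zmod.

Definition subquot : Type := {ideal_quot sq_ideal_pred}.

HB.instance Definition _ :=
  GRing.Zmodule.copy subquot {ideal_quot sq_ideal_pred}.

(* junk value 0 outside S *)
Definition sq_class (x : R) : subquot :=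
  \pi_({ideal_quot sq_ideal_pred}) (insubd 0 x).

Definition sq_pi (u : sq_sub) : subquot := \pi_({ideal_quot sq_ideal_pred}) u.

Lemma sq_pi_eq u w : (sq_pi u = sq_pi w) <-> (sq_ideal D (sq_val u - sq_val w)).
Proof.
rewrite /sq_pi; split=> [/eqP|H].
  by rewrite -Quotient.idealrBE => /set_mem.
by apply/eqP; rewrite -Quotient.idealrBE; apply/mem_set.
Qed.

Lemma sq_valP (u : sq_sub) : sq_ring D (sq_val u).
Proof. by case: u => x Sx; apply: set_mem. Qed.

Definition sq_rep (q : subquot) : sq_sub :=
  repr (q : {ideal_quot sq_ideal_pred}).

Lemma sq_repK q : sq_pi (sq_rep q) = q.
Proof. exact: reprK. Qed.

Definition sq_one : subquot := sq_pi 1.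
Definition sq_mul (p q : subquot) : subquot := sq_pi (sq_rep p * sq_rep q).

Lemma sq_mulE u w : sq_mul (sq_pi u) (sq_pi w) = sq_pi (u * w).
Proof.
apply/sq_pi_eq => /=; have Sv := sq_valP.
set u' := sq_rep _; set w' := sq_rep _.
have /sq_pi_eq Hu : sq_pi u' = sq_pi u by rewrite sq_repK.
have /sq_pi_eq Hw : sq_pi w' = sq_pi w by rewrite sq_repK.
have -> : sq_val u' * sq_val w' - sq_val u * sq_val w =
  (sq_val u' - sq_val u) * sq_val w' - sq_val u * - (sq_val w' - sq_val w).
  by rewrite mulrN opprK mulrBl mulrBr addrA subrK.
apply: sq_idealB; first exact: sq_idealMr.
apply: sq_idealMl => //; rewrite -sub0r.
by apply: sq_idealB => //; apply: sq_ideal0.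
Qed.

Lemma sq_piD u w : sq_pi u + sq_pi w = sq_pi (u + w).
Proof. by symmetry; apply: Quotient.pi_add. Qed.

Lemma sq_mulA : associative sq_mul.
Proof.
move=> p q r; rewrite -[p]sq_repK -[q]sq_repK -[r]sq_repK.
by rewrite !sq_mulE mulrA.
Qed.

Lemma sq_mul1q : left_id sq_one sq_mul.
Proof. by move=> p; rewrite -[p]sq_repK /sq_one sq_mulE mul1r. Qed.

Lemma sq_mulq1 : right_id sq_one sq_mul.
Proof. by move=> p; rewrite -[p]sq_repK /sq_one sq_mulE mulr1. Qed.

Lemma sq_mulDl : left_distributive sq_mul +%R.
Proof.
move=> p q r; rewrite -[p]sq_repK -[q]sq_repK -[r]sq_repK.
by rewrite sq_piD !sq_mulE sq_piD mulrDl.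
Qed.

Lemma sq_mulDr : right_distributive sq_mul +%R.
Proof.
move=> p q r; rewrite -[p]sq_repK -[q]sq_repK -[r]sq_repK.
by rewrite sq_piD !sq_mulE sq_piD mulrDr.
Qed.

HB.instance Definition _ := GRing.Zmodule_isPzRing.Build subquot
  sq_mulA sq_mul1q sq_mulq1 sq_mulDl sq_mulDr.

Lemma sq_pi_sub x (Sx : sq_ring D x) : sq_class x = sq_pi (SqSub (mem_set Sx)).
Proof.
rewrite /sq_class /sq_pi; congr (\pi_(_) _); apply: val_inj => /=.
by rewrite val_insubd; case: ifP => // /negP[]; apply: mem_set.
Qed.

Lemma sq_class_eq x y : sq_ring D x -> sq_ring D y ->
  (sq_class x = sq_class y) <-> sq_ideal D (x - y).
Proof. by move=> Sx Sy; rewrite !sq_pi_sub; apply: sq_pi_eq. Qed.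

Lemma sq_class_surj (q : subquot) : exists2 x, sq_ring D x & q = sq_class x.
Proof.
exists (sq_val (sq_rep q)); first exact: sq_valP.
rewrite sq_pi_sub; first exact: sq_valP.
move=> Sq; rewrite -[LHS]sq_repK.
by congr sq_pi; apply: val_inj.
Qed.

Lemma sq_class1 : sq_class 1 = 1.
Proof. by rewrite (sq_pi_sub (sq_ring1 D)); congr sq_pi; apply: val_inj. Qed.

Lemma sq_classD x y : sq_ring D x -> sq_ring D y ->
  sq_class (x + y) = sq_class x + sq_class y.
Proof.
move=> Sx Sy; have S0 : sq_ring D 0 by rewrite -(subrr x); apply: sq_ringB.
have Sxy : sq_ring D (x + y).
  by rewrite -[y]opprK -[- y]sub0r; do 2!apply: sq_ringB => //.
by rewrite !sq_pi_sub sq_piD; congr sq_pi; apply: val_inj.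
Qed.

Lemma sq_classM x y : sq_ring D x -> sq_ring D y ->
  sq_class (x * y) = sq_class x * sq_class y.
Proof.
move=> Sx Sy; rewrite (sq_pi_sub (sq_ringM Sx Sy)) !sq_pi_sub.
by rewrite [RHS]sq_mulE; congr sq_pi; apply: val_inj.
Qed.

End Subquotient.

Arguments sq_class {R} D x.

(* Filtrations.  [filtration] is the general notion, which also covers the    *)
(* valuation filtration of K and F^v; [alg_filtration] is that of a           *)
(* K-algebra, with K contained in F_0.                                        *)

Record filtration (R : pzRingType) := Filtration {
  filt :> int -> set R;
  filt0 : forall n, filt n 0;
  filtB : forall n x y, filt n x -> filt n y -> filt n (x - y);
  filt_homo : forall m n, m <= n -> filt m `<=` filt n;
  filtM : forall m n x y, filt m x -> filt n y -> filt (m + n) (x * y);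
  filt1 : filt 0 1
}.

Record alg_filtration (K : fieldType) (A : algType K) := AlgFiltration {
  alg_filt :> filtration A;
  alg_filtK : forall c : K, alg_filt 0 c%:A
}.

Definition exhaustive (T : Type) (F : int -> set T) := \bigcup_n F n = setT.

Definition separated (V : zmodType) (F : int -> set V) :=
  \bigcap_n F n = [set 0].

Section FiltrationTheory.
Variables (R : pzRingType) (F : filtration R).

Lemma filtN n x : F n x -> F n (- x).
Proof. by move=> Fx; rewrite -sub0r; apply: filtB => //; apply: filt0. Qed.

Lemma filtD n x y : F n x -> F n y -> F n (x + y).
Proof. by move=> Fx Fy; rewrite -[y]opprK; apply/filtB/filtN. Qed.

Lemma filt_sum n (I : Type) (r : seq I) (P : pred I) (E : I -> R) :
  (forall i, P i -> F n (E i)) -> F n (\sum_(i <- r | P i) E i).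
Proof. by apply: big_ind => [|x y]; [apply: filt0 | apply: filtD]. Qed.

End FiltrationTheory.

(* The associated graded ring: (+)_n F_n / F_{n-1} is the quotient of the     *)
(* Rees ring (+)_n F_n t^n of R[t,t^-1] by its ideal (+)_n F_{n-1} t^n.       *)

Section AssociatedGraded.
Variables (R : pzRingType) (F : filtration R).

Definition rees_ring : set (laurent R) := [set f | forall n, F n f@_n].
Definition rees_ideal : set (laurent R) := [set f | forall n, F (n - 1) f@_n].

Lemma coef_mul_filt (s : int) (f g : laurent R) :
  (forall i j, F (i + j + s) (f@_i * g@_j)) -> forall n, F (n + s) (f * g)@_n.
Proof.
move=> H n; rewrite laurent_mulE raddf_sum; apply: filt_sum => i _.
rewrite raddf_sum; apply: filt_sum => j _ /=.
rewrite coef_lmono; case: eqP => [<-|_]; [exact: H | exact: filt0].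
Qed.

Lemma coef_sub (f g : laurent R) n : (f - g)@_n = f@_n - g@_n.
Proof. exact: mcoeffB. Qed.

Lemma rees_ring1 : rees_ring 1.
Proof.
move=> n; rewrite coef_lmono; case: eqP => [<-|_]; first exact: filt1.
exact: filt0.
Qed.

Lemma rees_ringB f g : rees_ring f -> rees_ring g -> rees_ring (f - g).
Proof. by move=> Sf Sg n; rewrite coef_sub; apply: filtB. Qed.

Lemma rees_ringM f g : rees_ring f -> rees_ring g -> rees_ring (f * g).
Proof.
move=> Sf Sg n; have := coef_mul_filt (s := 0) _ n; rewrite addr0; apply=> i j.
by rewrite addr0; apply: filtM.
Qed.

Lemma rees_idealS : rees_ideal `<=` rees_ring.
Proof. by move=> f If n; apply: filt_homo (If n); rewrite gerBl. Qed.

Lemma rees_ideal0 : rees_ideal 0.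
Proof. by move=> n; rewrite mcoeff0; apply: filt0. Qed.

Lemma rees_idealB f g : rees_ideal f -> rees_ideal g -> rees_ideal (f - g).
Proof. by move=> If Ig n; rewrite coef_sub; apply: filtB. Qed.

Lemma rees_idealMl f g : rees_ring f -> rees_ideal g -> rees_ideal (f * g).
Proof.
move=> Sf Ig n; apply: (coef_mul_filt (s := - 1)) => i j.
by rewrite -addrA; apply: filtM.
Qed.

Lemma rees_idealMr f g : rees_ideal f -> rees_ring g -> rees_ideal (f * g).
Proof.
move=> If Sg n; apply: (coef_mul_filt (s := - 1)) => i j.
by rewrite addrAC; apply: filtM.
Qed.

Definition rees_data := SubquotData rees_ring1 rees_ringB rees_ringM rees_idealS
  rees_ideal0 rees_idealB rees_idealMl rees_idealMr.

Definition gr : Type := subquot rees_data.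

HB.instance Definition _ := GRing.PzRing.copy gr (subquot rees_data).

(* the class in F_n / F_{n-1} of x in F_n *)
Definition gr_class (n : int) (x : R) : gr := sq_class rees_data (lmono n x).

Definition gr_deg (n : int) : set gr := gr_class n @` F n.

(* the image in gr of (+)_n X_n, for subgroups X_n of F_n *)
Definition gr_sub (X : int -> set R) : set gr :=
  [set sq_class rees_data f | f in [set f | forall n, X n f@_n]].

Lemma rees_lmono n x : F n x -> rees_ring (lmono n x).
Proof.
by move=> Fx i; rewrite coef_lmono; case: eqP => [<-//|_]; apply: filt0.
Qed.

End AssociatedGraded.
Arguments gr_class {R} F n x.
Arguments gr_deg {R} F n.
Arguments gr_sub {R} F X.

(* The filtration on gr F' induced by a filtration F on the same ring. *)
Definition induced_filt (R : pzRingType) (F F' : filtration R) (n : int) :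
  set (gr F') := gr_sub F' (fun j => F n `&` F' j).
Arguments induced_filt {R} F F' n.

(* For a filtration of a K-algebra, gr is a K-vector space through            *)
(* K -> F_0 / F_{-1}.                                                         *)
Section GradedScale.
Variables (K : fieldType) (A : algType K) (F : alg_filtration A).
Local Notation G := (gr (alg_filt F)).

Definition gr_scale (c : K) (g : G) : G := gr_class F 0 c%:A * g.

Lemma rees_ringK (c : K) : sq_ring (rees_data F) (lmono 0 c%:A).
Proof. exact/rees_lmono/alg_filtK. Qed.

Lemma gr_scaleA c d g : gr_scale c (gr_scale d g) = gr_scale (c * d) g.
Proof.
rewrite /gr_scale mulrA -[_ * gr_class F 0 d%:A]sq_classM;
  [|exact: rees_ringK..]; rewrite lmonoM addr0.
by rewrite -scalerAl mul1r scalerA.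
Qed.

Lemma gr_scale1 : left_id 1 gr_scale.
Proof.
by move=> g; rewrite /gr_scale scale1r [gr_class _ _ _]sq_class1 mul1r.
Qed.

Lemma gr_scaleDr : right_distributive gr_scale +%R.
Proof. by move=> c g h; rewrite /gr_scale mulrDr. Qed.

Lemma gr_scaleDl g : {morph gr_scale^~ g : c d / c + d}.
Proof.
move=> c d; rewrite /gr_scale -mulrDl scalerDl /gr_class lmonoD.
by rewrite [sq_class _ _]sq_classD //; apply: rees_ringK.
Qed.

HB.instance Definition _ := GRing.Zmodule_isLmodule.Build K (gr (alg_filt F))
  gr_scaleA gr_scale1 gr_scaleDr gr_scaleDl.

End GradedScale.

(* Discrete valuation rings with field of fractions K, as the valuation rings *)
(* of the discrete valuations v of K; the value [v 0] is irrelevant.          *)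

Record discrete_valuation (K : fieldType) := DiscreteValuation {
  dval :> K -> int;
  dvalM : forall x y, x != 0 -> y != 0 -> dval (x * y) = dval x + dval y;
  dvalD : forall x y, x != 0 -> y != 0 -> x + y != 0 ->
    Num.min (dval x) (dval y) <= dval (x + y);
  dval_surj : forall n, exists2 x, x != 0 & dval x = n
}.

Section Valuation.
Variables (K : fieldType) (v : discrete_valuation K).

Definition Ov : set K := [set x | x = 0 \/ 0 <= v x].
Definition mv : set K := [set x | x = 0 \/ 0 < v x].

Record uniformizer := Uniformizer {
  unif :> K;
  unif_gen : mv = [set unif * a | a in Ov]
}.

Lemma dval1 : v 1 = 0.
Proof.
have := dvalM v (oner_neq0 K) (oner_neq0 K); rewrite mul1r => /eqP.
by rewrite -subr_eq0 opprD addrA subrr sub0r oppr_eq0 => /eqP.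
Qed.

Lemma dvalN x : v (- x) = v x.
Proof.
have [->|x0] := eqVneq x 0; first by rewrite oppr0.
have n10 : (-1 : K) != 0 by rewrite oppr_eq0 oner_neq0.
have vn1 : v (-1) = 0.
  have := dvalM v n10 n10; rewrite mulrNN mulr1 dval1 => /esym /eqP.
  by rewrite -mulr2n mulrn_eq0 /= => /eqP.
by rewrite -mulN1r dvalM // vn1 add0r.
Qed.

Lemma Ov0 : Ov 0. Proof. by left. Qed.

Lemma Ov1 : Ov 1. Proof. by right; rewrite dval1. Qed.

Lemma OvM x y : Ov x -> Ov y -> Ov (x * y).
Proof.
have [->|x0] := eqVneq x 0; first by rewrite mul0r.
have [->|y0] := eqVneq y 0; first by rewrite mulr0.
case=> [/eqP|vx]; first by rewrite (negPf x0).
case=> [/eqP|vy]; first by rewrite (negPf y0).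
by right; rewrite dvalM // addr_ge0.
Qed.

Lemma OvB x y : Ov x -> Ov y -> Ov (x - y).
Proof.
have [->|x0] := eqVneq x 0.
  by rewrite sub0r => _ [->|vy]; [left; rewrite oppr0 | right; rewrite dvalN].
have [->|y0] := eqVneq y 0; first by rewrite subr0.
have [->|xy0] := eqVneq (x - y) 0; first by left.
case=> [/eqP|vx]; first by rewrite (negPf x0).
case=> [/eqP|vy]; first by rewrite (negPf y0).
right; apply: le_trans (dvalD v x0 _ xy0); rewrite ?oppr_eq0 //.
by rewrite le_min vx dvalN.
Qed.

Variable pi : uniformizer.

Lemma unif_Ov : Ov pi.
Proof.
have : mv pi by rewrite (unif_gen pi); exists 1; rewrite ?mulr1 //; apply: Ov1.
by case=> [->|/ltW]; [left | right].
Qed.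

Lemma unif_neq0 : (pi : K) != 0.
Proof.
have [x x0 vx] := dval_surj v 1.
have : mv x by right; rewrite vx.
rewrite (unif_gen pi) => -[a _ xE].
by apply: contraNneq x0 => p0; rewrite -xE p0 mul0r.
Qed.

Lemma unif_exp_Ov (n : int) : 0 <= n -> Ov ((pi : K) ^ n).
Proof.
case: n => // n _; rewrite -exprnP; elim: n => [|n IHn]; first exact: Ov1.
by rewrite exprS; apply: OvM => //; apply: unif_Ov.
Qed.

(* f^v_n K = m_v^{-n} *)
Definition val_filt_set (n : int) : set K :=
  [set (pi : K) ^ (- n) * a | a in Ov].

Lemma val_filt0 n : val_filt_set n 0.
Proof. by exists 0; rewrite ?mulr0 //; apply: Ov0. Qed.

Lemma val_filtB n x y :
  val_filt_set n x -> val_filt_set n y -> val_filt_set n (x - y).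
Proof.
by move=> [a Oa <-] [b Ob <-]; exists (a - b); rewrite ?mulrBr //; apply: OvB.
Qed.

Lemma val_filt_homo m n : m <= n -> val_filt_set m `<=` val_filt_set n.
Proof.
move=> mn x [a Oa <-]; exists ((pi : K) ^ (n - m) * a).
  by apply: OvM => //; apply: unif_exp_Ov; rewrite subr_ge0.
by rewrite mulrA -expfzDr ?unif_neq0 // addrA addNr add0r.
Qed.

Lemma val_filtM m n x y :
  val_filt_set m x -> val_filt_set n y -> val_filt_set (m + n) (x * y).
Proof.
move=> [a Oa <-] [b Ob <-]; exists (a * b); first exact: OvM.
by rewrite opprD expfzDr ?unif_neq0 // mulrACA.
Qed.

Lemma val_filt1 : val_filt_set 0 1.
Proof. by exists 1; rewrite ?oppr0 ?expr0z ?mulr1 //; apply: Ov1. Qed.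

Definition val_filt : filtration K :=
  Filtration val_filt0 val_filtB val_filt_homo val_filtM val_filt1.

End Valuation.

(* Finiteness of O_v-modules, all of them living in K-vector spaces. *)

Section Modules.
Variables (K : fieldType) (V : lmodType K).
Implicit Types (C : set K) (M W : set V).

(* combinations of e with coefficients in the subring C of K *)
Definition lincomb C n (e : 'I_n -> V) : set V :=
  [set \sum_i c i *: e i | c in [set c : 'I_n -> K | forall i, C (c i)]].

Definition lin_indep C n (e : 'I_n -> V) : Prop :=
  forall c : 'I_n -> K, (forall i, C (c i)) ->
    \sum_i c i *: e i = 0 -> forall i, c i = 0.

Definition fin_gen C M : Prop :=
  exists n, exists e : 'I_n -> V, M = lincomb C e.

Definition has_rank C M (n : nat) : Prop :=
  (exists e : 'I_n -> V, (forall i, M (e i)) /\ lin_indep C e) /\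
  (forall m (e : 'I_m -> V),
    (forall i, M (e i)) -> lin_indep C e -> (m <= n)%N).

Definition has_dim W (n : nat) : Prop :=
  exists e : 'I_n -> V, lin_indep setT e /\ W = lincomb setT e.

Definition is_lattice (v : discrete_valuation K) W M : Prop :=
  [/\ M `<=` W, fin_gen (Ov v) M &
      exists n, has_dim W n /\ has_rank (Ov v) M n].

Definition scale_set (c : K) M : set V := [set c *: x | x in M].

End Modules.

(* FM is a good filtration of the submodule M of V. *)
Definition good_filtration (R : pzRingType) (V : lmodType R) (fR : filtration R)
    (M : set V) (FM : int -> set V) : Prop :=
  exists (s : nat) (m : 'I_s -> V) (d : 'I_s -> int),
    (forall i, M (m i)) /\
    forall n, FM n = [set \sum_i c i *: m i |
                       c in [set c : 'I_s -> R | forall i, fR (n - d i) (c i)]].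

(* Not assumed finitely generated over O_v; [ord_span] is K L = A. *)
Record Ov_order (K : fieldType) (v : discrete_valuation K) (A : algType K) :=
  Order {
  ord :> set A;
  ord1 : ord 1;
  ordB : forall x y, ord x -> ord y -> ord (x - y);
  ordM : forall x y, ord x -> ord y -> ord (x * y);
  ordK : forall c : K, ord c%:A <-> Ov v c;
  ord_span : forall x : A, exists n, exists e : 'I_n -> A,
    (forall i, ord (e i)) /\ lincomb setT e x
}.

Section Order.
Variables (K : fieldType) (v : discrete_valuation K) (pi : uniformizer v).
Variables (A : algType K) (L : Ov_order v A).

Lemma ordZ c x : Ov v c -> ord L x -> ord L (c *: x).
Proof.
by move=> Oc Lx; rewrite -[x]mul1r scalerAl; apply: ordM => //; apply/ordK.
Qed.

Lemma ord_zero : ord L 0.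
Proof. by rewrite -(subrr 1); apply: ordB; apply: ord1. Qed.

(* F^v_n A = m_v^{-n} L *)
Definition Fv_set (n : int) : set A := scale_set ((pi : K) ^ (- n)) L.

Lemma Fv0 n : Fv_set n 0.
Proof. by exists 0; [exact: ord_zero | rewrite scaler0]. Qed.

Lemma FvB n x y : Fv_set n x -> Fv_set n y -> Fv_set n (x - y).
Proof.
move=> [a La <-] [b Lb <-].
by exists (a - b); rewrite ?scalerBr //; apply: ordB.
Qed.

Lemma Fv_homo m n : m <= n -> Fv_set m `<=` Fv_set n.
Proof.
move=> mn x [a La <-]; exists ((pi : K) ^ (n - m) *: a).
  by apply: ordZ => //; apply: unif_exp_Ov; rewrite subr_ge0.
by rewrite scalerA -expfzDr ?unif_neq0 // addrA addNr add0r.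
Qed.

Lemma FvM m n x y : Fv_set m x -> Fv_set n y -> Fv_set (m + n) (x * y).
Proof.
move=> [a La <-] [b Lb <-]; exists (a * b); first exact: ordM.
by rewrite -scalerAl -scalerAr scalerA -expfzDr ?unif_neq0 // opprD.
Qed.

Lemma Fv1 : Fv_set 0 1.
Proof. by exists 1; rewrite ?oppr0 ?expr0z ?scale1r //; apply: ord1. Qed.

Definition Fv : filtration A := Filtration Fv0 FvB Fv_homo FvM Fv1.

Definition mv_ord : set A := scale_set pi L.

Lemma mv_ordS : mv_ord `<=` L.
Proof. by move=> _ [x Lx <-]; apply: ordZ => //; apply: unif_Ov. Qed.

Lemma mv_ord0 : mv_ord 0. Proof. by exists 0; [exact: ord_zero | rewrite scaler0]. Qed.

Lemma mv_ordB x y : mv_ord x -> mv_ord y -> mv_ord (x - y).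
Proof.
move=> [a La <-] [b Lb <-].
by exists (a - b); rewrite ?scalerBr //; apply: ordB.
Qed.

Lemma mv_ordMl x y : ord L x -> mv_ord y -> mv_ord (x * y).
Proof.
by move=> Lx [b Lb <-]; exists (x * b); rewrite ?scalerAr //; apply: ordM.
Qed.

Lemma mv_ordMr x y : mv_ord x -> ord L y -> mv_ord (x * y).
Proof.
by move=> [a La <-] Ly; exists (a * y); rewrite ?scalerAl //; apply: ordM.
Qed.

Definition Av_data : subquot_data A :=
  SubquotData (ord1 L) (@ordB _ _ _ L) (@ordM _ _ _ L) mv_ordS
    mv_ord0 mv_ordB mv_ordMl mv_ordMr.

(* A_v = L / m_v L *)
Definition Av : Type := subquot Av_data.

HB.instance Definition _ := GRing.PzRing.copy Av (subquot Av_data).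

Definition red (x : A) : Av := sq_class Av_data x.

(* U is M / m_v M, for M contained in L: the reduction modulo m_v L maps M    *)
(* onto U with kernel m_v M.                                                  *)
Definition is_reduction (M : set A) (U : set Av) : Prop :=
  U = red @` M /\ forall x, M x -> (red x = 0 <-> scale_set pi M x).

Definition unramified_reduction (W M : set A) (U : set Av) : Prop :=
  is_lattice v W M /\ is_reduction M U.

Variable F : alg_filtration A.

Definition FL (n : int) : set A := L `&` F n.

(* the degree d part of G_F(L), as a subset of G_F(A) *)
Definition GL_deg (d : int) : set (gr (alg_filt F)) := gr_class F d @` FL d.

Definition GL : set (gr (alg_filt F)) := gr_sub F FL.

(* f^v_n G_F(A) = m_v^{-n} G_F(L) *)
Definition fvG (n : int) : set (gr (alg_filt F)) :=
  scale_set ((pi : K) ^ (- n)) GL.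

Definition FA_finite : Prop := forall d, fin_gen (Ov v) (FL d).

Definition GA_finite : Prop := forall d, fin_gen (Ov v) (GL_deg d).

(* The induced filtration on G_{F^v}(A), and its restriction to A_v, which is *)
(* G_{F^v}(A)_0 through [red x] <-> [gr_class Fv 0 x].                        *)
Definition Fbar (n : int) : set (gr Fv) := induced_filt F Fv n.

Definition Fbar_Av (n : int) : set Av :=
  [set red x | x in L `&` [set x | Fbar n (gr_class Fv 0 x)]].

End Order.

Arguments GL_deg {K v A} L F d.
Arguments GL {K v A} L F.
Arguments fvG {K v} pi {A} L F n.
Arguments Fbar {K v} pi {A} L F n.
Arguments Fbar_Av {K v} pi {A} L F n.
Arguments is_reduction {K v} pi {A} L M U.
Arguments unramified_reduction {K v} pi {A} L W M U.

(* Main.v *)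
Require Import Defs.
From HB Require Import structures.
From mathcomp Require Import all_boot all_order all_algebra.
From mathcomp Require Import finmap monalg.
From mathcomp Require Import boolp classical_sets.
From mathcomp Require Import zify.
Import Order.TTheory GRing.Theory Num.Theory.

Set Implicit Arguments.
Unset Strict Implicit.
Unset Printing Implicit Defensive.

Local Open Scope classical_set_scope.
Local Open Scope ring_scope.

(* A finitely generated O_v-submodule of a K-vector space has a K-linearly     *)
(* independent generating family, so its only infinitely pi-divisible element *)
(* is 0.  A nonzero x has a nonzero symbol in some degree d of G_F(A), and if *)
(* all pi^-n x lie in L then that symbol is infinitely divisible in           *)
(* G_F(L)_d; hence F^vA is separated, and likewise f^vG_F(A).  Applied to     *)
(* F_d L, the same basis spans F_d A over K, which gives the lattice property *)
(* and the good filtration.  Finally f = sum_i f_i t^i in the Rees ring of    *)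
(* F^vA is determined modulo lower terms by the reductions of pi^i f_i, and   *)
(* this identifies G_{F^v}(A) with A_v[t,t^-1].                               *)

(** Two mechanisms carry the proof. The first is divisibility: coordinates in a K-independent
    generating family ([Ov_basis]) are unique, so a finitely generated O_v-module contains no
    nonzero element divisible by every power of pi ([fin_gen_divisible]). Applied to symbols in the
    pieces of G_F(L), this gives both separatedness statements; FA-finiteness implies finiteness of
    these pieces. Since L spans A, a basis of F_d L over O_v is also a basis of F_d A over K
    ([FL_basis]), whence the lattice and the good filtration.

    The second is rescaling: multiplication by pi^n carries F^v_n A onto L and F^v_{n-1} A onto m_v
    L, so every graded piece of G_{F^v}(A) is a copy of A_v. Scalars being central, these copies
    multiply as in A_v[t,t^-1] ([laurent_to_grE], [laurent_to_gr_monoid]). Each F_n A is a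
    K-subspace, hence stable under rescaling, so the induced filtration is the same in every degree
    ([laurent_to_gr_Fbar]). *)

Section ValuationRing.
Variables (K : fieldType) (v : discrete_valuation K).

(** Some x of value 1 equals pi * a with a integral, while pi itself has positive value; this leaves
    only the value 1. *)
Lemma dval_unif (pi : uniformizer v) : v pi = 1.
Proof.
have p0 := unif_neq0 pi.
have [x x0 vx] := dval_surj v 1.
have : mv v x by right; rewrite vx.
rewrite (unif_gen pi) => -[a Oa xE]; move: vx.
have a0 : a != 0 by apply: contraNneq x0 => a0; rewrite -xE a0 mulr0.
rewrite -xE dvalM //.
have : mv v pi by rewrite (unif_gen pi); exists 1; [apply: Ov1|rewrite mulr1].
case=> [/eqP|]; first by rewrite (negPf p0).
case: Oa => [/eqP|]; first by rewrite (negPf a0).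
by lia.
Qed.

Lemma dvalX x (n : nat) : x != 0 -> v (x ^+ n) = v x *+ n.
Proof.
move=> x0; elim: n => [|n IHn]; first by rewrite expr0 dval1.
by rewrite exprS dvalM ?expf_neq0 // IHn mulrS.
Qed.

Lemma unif_divisible_eq0 (pi : uniformizer v) c :
  (forall n : nat, Ov v ((pi : K) ^- n * c)) -> c = 0.
Proof.
move=> H; apply/eqP; apply: contraT => c0.
(* This power of pi has value exceeding that of c, so the quotient cannot be integral. *)
have p0 := unif_neq0 pi; set n := `|v c|%N.+1.
have u0 : (pi : K) ^+ n != 0 by rewrite expf_neq0.
case: (H n) => [/eqP|]; first by rewrite mulf_eq0 invr_eq0 (negPf u0) (negPf c0).
have : v c = v ((pi : K) ^+ n) + v ((pi : K) ^- n * c).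
  by rewrite -dvalM ?mulf_neq0 ?invr_eq0 // mulVKf.
rewrite dvalX // dval_unif /n; lia.
Qed.

Lemma Ov_min_coef n (c : 'I_n -> K) i0 : c i0 != 0 ->
  exists2 i, c i != 0 & forall j, Ov v (c j / c i).
Proof.
move=> ci0; case: (arg_minP (fun i => v (c i)) (P := fun i => c i != 0) ci0).
move=> i ci mini; exists i => // j.
have [->|cj] := eqVneq (c j) 0; first by rewrite mul0r; apply: Ov0.
right; have := dvalM v (mulf_neq0 cj (invr_neq0 ci)) ci.
rewrite divfK // => vj; by have := mini j cj; rewrite vj lerDr.
Qed.

(** The inverse of a nonzero coefficient of least valuation is a common multiplier. *)
Lemma Ov_denominator n (c : 'I_n -> K) :
  exists2 d, d != 0 & forall i, Ov v (d * c i).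
Proof.
have [[i0 ci0]|c0] := pselect (exists i, c i != 0).
  have [i ci Oc] := Ov_min_coef ci0.
  by exists (c i)^-1 => [|j]; rewrite ?invr_eq0 // mulrC.
exists 1 => [|i]; first exact: oner_neq0.
have [->|ci] := eqVneq (c i) 0; last by case: c0; exists i.
by rewrite mulr0; apply: Ov0.
Qed.

End ValuationRing.

(** * Finitely generated O_v-modules inside K-vector spaces *)

Section Lattices.
Variables (K : fieldType) (v : discrete_valuation K) (V : lmodType K).

Lemma lin_indep_Ov n (e : 'I_n -> V) :
  lin_indep (Ov v) e -> lin_indep setT e.
Proof.
move=> ie c _ ce0 i; have [d d0 Od] := Ov_denominator v c.
have /eqP : d * c i = 0.
  apply: (ie (fun i => d * c i)) => //.
  by under eq_bigr do rewrite -scalerA; rewrite -scaler_sumr ce0 scaler0.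
by rewrite mulf_eq0 (negPf d0) => /eqP.
Qed.

Lemma lincomb_gen (C : set K) n (e : 'I_n -> V) i :
  C 0 -> C 1 -> lincomb C e (e i).
Proof.
move=> C0 C1; exists (fun j => (j == i)%:R) => [j|]; first by case: eqP.
rewrite (bigD1 i) //= eqxx scale1r big1 ?addr0 // => j /negPf ->.
exact: scale0r.
Qed.

(* In a nontrivial relation a coefficient of least valuation divides the      *)
(* others, so the corresponding generator is redundant.                       *)
Lemma Ov_basis n (e : 'I_n -> V) : exists m (b : 'I_m -> V),
  lin_indep setT b /\ lincomb (Ov v) e = lincomb (Ov v) b.
Proof.
elim: n e => [|n IHn] e.
  by exists 0%N, e; split=> // c _ _ [].
have [ie|] := pselect (lin_indep setT e); first by exists n.+1, e.
move=> /existsNP[c /not_implyP[_ /not_implyP[ce0 /existsNP[i0 /eqP ci0]]]].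
have [i ci Oc] := Ov_min_coef v ci0.
have [m [b [ib eb]]] := IHn (e \o lift i).
exists m, b; split=> //; rewrite -eb.
have ei : e i = \sum_j (- (c (lift i j) / c i)) *: e (lift i j).
  move: ce0; rewrite (bigD1_ord i) //= => /addr0_eq ce0.
  rewrite -[LHS](scalerK ci) -[c i *: e i]opprK ce0 scalerN scaler_sumr -sumrN.
  by apply: eq_bigr => j _; rewrite scalerA scaleNr mulrC.
rewrite eqEsubset; split=> x [a Oa <-].
  exists (fun j => a (lift i j) - a i * (c (lift i j) / c i)).
    by move=> j; apply: OvB => //; apply: OvM.
  rewrite [RHS](bigD1_ord i) //= ei scaler_sumr -big_split /=.
  by apply: eq_bigr => j _; rewrite scalerBl scalerA mulrN scaleNr addrC.
exists (fun j => if unlift i j is Some k then a k else 0).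
  by move=> j; case: unliftP => [k _|_] //; apply: Ov0.
rewrite (bigD1_ord i) //= unlift_none scale0r add0r.
by apply: eq_bigr => j _; rewrite liftK.
Qed.

Lemma fin_gen_basis (M : set V) : fin_gen (Ov v) M ->
  exists n (e : 'I_n -> V), lin_indep setT e /\ M = lincomb (Ov v) e.
Proof. by move=> [n [e ->]]; apply: Ov_basis. Qed.

Lemma lin_indep_inj n (e : 'I_n -> V) (a b : 'I_n -> K) : lin_indep setT e ->
  \sum_i a i *: e i = \sum_i b i *: e i -> a =1 b.
Proof.
move=> ie ab i; apply/eqP; rewrite -subr_eq0; apply/eqP; move: i; apply: ie => //.
under eq_bigr do rewrite scalerBl.
by rewrite sumrB ab subrr.
Qed.

(** By uniqueness of coordinates, those of pi^-k x are pi^-k times those of x. All are integral, so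
    each coordinate of x vanishes. *)
Lemma fin_gen_divisible (pi : uniformizer v) (M : set V) x :
  fin_gen (Ov v) M -> (forall n : nat, M ((pi : K) ^- n *: x)) -> x = 0.
Proof.
move=> /fin_gen_basis[n [e [ie ->]]] Mx.
have [c _] := Mx 0%N; rewrite expr0 invr1 scale1r => cE.
rewrite -cE big1 // => i _; suff -> : c i = 0 by rewrite scale0r.
apply: (unif_divisible_eq0 (pi := pi)) => k.
have [d Od dE] := Mx k.
suff <- : d i = (pi : K) ^- k * c i by [].
apply: (lin_indep_inj ie (b := fun i => (pi : K) ^- k * c i)).
rewrite {}dE -cE scaler_sumr.
by apply: eq_bigr => j _; rewrite scalerA.
Qed.

Lemma lin_indep_card n m (e : 'I_n -> V) (f : 'I_m -> V) :
  (forall i, lincomb setT e (f i)) -> lin_indep setT f -> (m <= n)%N.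
Proof.
move=> fe indf; rewrite leqNgt; apply/negP => nm.
have [c cE] : {c : 'I_m -> 'I_n -> K & forall i, f i = \sum_j c i j *: e j}.
  apply: (choice (P := fun i d => f i = \sum_j d j *: e j)) => i.
  by have [d _ dE] := fe i; exists d.
pose C := \matrix_(i, j) c i j.
(* The coefficient matrix has more rows than columns; a nonzero vector of its left kernel is a
   relation among the f i. *)
have /rowV0Pn[u /sub_kermxP uC /rV0Pn[i /eqP[]]] : kermx C != 0.
  rewrite -mxrank_eq0 mxrank_ker subn_eq0 -ltnNge.
  exact: leq_ltn_trans (rank_leq_col C) nm.
apply: (indf (fun i => u 0 i)) => //.
under eq_bigr do rewrite cE scaler_sumr.
rewrite exchange_big big1 // => j _ /=.
under eq_bigr do rewrite scalerA.
rewrite -scaler_suml.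
suff -> : \sum_k u 0 k * c k j = 0 by rewrite scale0r.
have /matrixP/(_ 0 j) := uC; rewrite !mxE => uCj.
by rewrite -[RHS]uCj; apply: eq_bigr => k _; rewrite mxE.
Qed.

(** The rank cannot exceed n because O_v-independence already forces K-independence, by clearing
    denominators. *)
Lemma lattice_lincomb n (e : 'I_n -> V) : lin_indep setT e ->
  is_lattice v (lincomb setT e) (lincomb (Ov v) e).
Proof.
move=> inde; split; first by move=> x [c _ <-]; exists c.
  by exists n, e.
exists n; split; first by exists e.
split.
  exists e; split=> [i|c _]; last exact: inde.
  by apply: lincomb_gen; [apply: Ov0 | apply: Ov1].
move=> m f fM /lin_indep_Ov; apply: lin_indep_card => i.
by have [c _ <-] := fM i; exists c.
Qed.
End Lattices.

(** * Symbols in the associated graded ring *)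

Section Graded.
Variables (R : pzRingType) (F : filtration R).

Lemma rees_class_eq f g : rees_ring F f -> rees_ring F g ->
  sq_class (rees_data F) f = sq_class (rees_data F) g <->
  forall n, F (n - 1) (f@_n - g@_n).
Proof.
move=> Ff Fg; rewrite sq_class_eq //.
by split=> H n; have := H n; rewrite coef_sub.
Qed.

Lemma gr_class_eq n x y : F n x -> F n y ->
  gr_class F n x = gr_class F n y <-> F (n - 1) (x - y).
Proof.
move=> Fx Fy; rewrite rees_class_eq; [|exact: rees_lmono..]; split=> [/(_ n)|H i].
  by rewrite !coef_lmono eqxx.
by rewrite !coef_lmono; case: eqP => [<-//|_]; rewrite subrr; apply: filt0.
Qed.

Lemma gr_class0 n : gr_class F n 0 = 0.
Proof.
have F0 := filt0 F n; apply: (addrI (gr_class F n 0)).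
by rewrite addr0 -[LHS]sq_classD -?lmonoD ?addr0 //; apply: rees_lmono.
Qed.

Lemma gr_class_eq0 n x : F n x -> gr_class F n x = 0 -> F (n - 1) x.
Proof.
move=> Fx; rewrite -(gr_class0 n) => /gr_class_eq-/(_ Fx (filt0 F n)).
by rewrite subr0.
Qed.

Lemma gr_class_sum n (I : Type) (r : seq I) (E : I -> R) :
  (forall i, F n (E i)) ->
  gr_class F n (\sum_(i <- r) E i) = \sum_(i <- r) gr_class F n (E i).
Proof.
move=> FE; elim: r => [|i r IHr]; first by rewrite !big_nil gr_class0.
rewrite !big_cons -IHr -[RHS]sq_classD -?lmonoD //; apply: rees_lmono => //.
exact: filt_sum.
Qed.

(** Without such a jump, membership would descend one degree at a time for ever, placing x in the
    intersection. *)
Lemma filt_level x : exhaustive F -> separated F -> x != 0 ->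
  exists2 d, F d x & ~ F (d - 1) x.
Proof.
move=> exhF sepF x0; apply: contrapT => noF.
have [n _ Fn] : (\bigcup_n F n) x by rewrite exhF.
have Fd (k : nat) : F (n - k%:Z) x.
  elim: k => [|k IHk]; first by rewrite subr0.
  apply: contrapT => nF; apply: noF; exists (n - k%:Z) => // H; apply: nF.
  by rewrite intS opprD addrA addrAC.
have : (\bigcap_n F n) x.
  by move=> m _; apply: filt_homo (Fd `|n - m|%N); lia.
by rewrite sepF => /eqP; rewrite (negPf x0).
Qed.

End Graded.

Lemma coef_lmono0M (R : pzRingType) (a : R) (g : laurent R) n :
  (lmono 0 a * g)@_n = a * g@_n.
Proof.
rewrite [X in _ * X@__]lmonoE [_ * g](lmulEr (lmono 0 a)) !raddf_sum mulr_sumr.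
apply: eq_bigr => j _ /=.
by rewrite lmul_mono add0r !coef_lmono; case: eqP; rewrite ?mulr0.
Qed.

(** * K-linearity of symbols *)

Section AlgebraFiltration.
Variables (K : fieldType) (A : algType K) (F : alg_filtration A).

Lemma alg_filtZ n c x : F n x -> F n (c *: x).
Proof.
move=> Fx; rewrite -[x]mul1r scalerAl -[n]add0r.
by apply: filtM => //; apply: alg_filtK.
Qed.

Lemma scale_sq_class (c : K) f : rees_ring F f ->
  c *: (sq_class (rees_data F) f : gr (alg_filt F)) =
  sq_class (rees_data F) (lmono 0 c%:A * f).
Proof. by move=> Ff; rewrite [RHS]sq_classM //; apply: rees_ringK. Qed.

Lemma gr_classZ n c x : F n x -> gr_class F n (c *: x) = c *: gr_class F n x.
Proof.
move=> Fx; rewrite scale_sq_class; last exact: rees_lmono.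
by rewrite lmonoM add0r -scalerAl mul1r.
Qed.

Lemma fin_gen_gr_class (v : discrete_valuation K) d (M : set A) : M `<=` F d ->
  fin_gen (Ov v) M -> fin_gen (Ov v) (gr_class F d @` M).
Proof.
move=> MF [n [e Me]]; exists n, (gr_class F d \o e).
have Fe i : F d (e i).
  by apply: MF; rewrite Me; apply: lincomb_gen; [apply: Ov0|apply: Ov1].
have grE (c : 'I_n -> K) : gr_class F d (\sum_i c i *: e i) =
    \sum_i c i *: gr_class F d (e i).
  rewrite gr_class_sum => [|i]; last exact: alg_filtZ.
  by apply: eq_bigr => i _; rewrite gr_classZ.
rewrite Me eqEsubset; split=> [_ [_ [c Oc <-] <-]|_ [c Oc <-]].
  by exists c; rewrite ?grE.
by exists (\sum_i c i *: e i); [exists c | rewrite grE].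
Qed.

End AlgebraFiltration.

(** * The order L: separatedness, lattices, good filtrations and reductions *)

Section OrderFiltration.
Variables (K : fieldType) (v : discrete_valuation K) (pi : uniformizer v).
Variables (A : algType K) (L : Ov_order v A) (F : alg_filtration A).

Lemma unif_expK (n : int) (V : lmodType K) (x : V) :
  (pi : K) ^ (- n) *: ((pi : K) ^ n *: x) = x.
Proof. by rewrite scalerA -expfzDr ?unif_neq0 // addNr expr0z scale1r. Qed.

Lemma unif_expVK (n : int) (V : lmodType K) (x : V) :
  (pi : K) ^ n *: ((pi : K) ^ (- n) *: x) = x.
Proof. by rewrite scalerA -expfzDr ?unif_neq0 // addrN expr0z scale1r. Qed.

Lemma FvE n x : Fv pi L n x <-> ord L ((pi : K) ^ n *: x).
Proof.
split=> [[a La <-]|Lx]; first by rewrite unif_expVK.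
by exists ((pi : K) ^ n *: x); rewrite // unif_expK.
Qed.

Lemma mv_ordE x : mv_ord pi L x <-> Fv pi L (- 1) x.
Proof. by rewrite /= /Fv_set opprK. Qed.

Lemma separated_Fv : exhaustive F -> separated F -> GA_finite L F ->
  separated (Fv pi L).
Proof.
move=> exhF sepF GAfin; rewrite /separated eqEsubset.
split=> [x Fx|_ -> n _]; last exact: filt0.
apply: contrapT => /eqP /(filt_level exhF sepF)[d Fdx]; apply.
apply: gr_class_eq0 => //; apply: (fin_gen_divisible (pi := pi)) (GAfin d) _.
move=> n; rewrite -gr_classZ //.
exists ((pi : K) ^- n *: x) => //; split; last exact: alg_filtZ.
(* Membership of x in F^v_{-n} A says exactly that pi^-n x lies in L. *)
by have /FvE := Fx (- n%:Z) I; rewrite -exprnN.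
Qed.

Lemma FA_finite_GA_finite : FA_finite L F -> GA_finite L F.
Proof. by move=> FAfin d; apply: fin_gen_gr_class => // x []. Qed.

(** The divisibility argument runs on each homogeneous component of x separately. *)
Lemma separated_fvG : GA_finite L F -> separated (fvG pi L F).
Proof.
move=> GAfin; rewrite /separated eqEsubset.
split=> [x Gx|_ -> n _]; last first.
  exists 0; last by rewrite scaler0.
  exists 0.
    by move=> m; rewrite mcoeff0; split; [apply: ord_zero | apply: filt0].
  by rewrite -(gr_class0 _ 0) /gr_class lmono0.
have [_ [f FLf <-] xE] := Gx 0 I.
have Ff : rees_ring F f by move=> n; have [] := FLf n.
move: xE; rewrite oppr0 expr0z scale1r => xE.
have F0 : rees_ring F 0 by move=> n; rewrite mcoeff0; apply: filt0.
rewrite -xE /= -(gr_class0 _ 0) /gr_class lmono0; apply/rees_class_eq => // d.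
rewrite mcoeff0 subr0; apply: gr_class_eq0 => //.
apply: (fin_gen_divisible (pi := pi)) (GAfin d) _ => n.
have [_ [g FLg <-]] := Gx (- n%:Z) I; rewrite opprK.
have Fg : rees_ring F g by move=> m; have [] := FLg m.
rewrite scale_sq_class // -xE => /rees_class_eq H.
(* This is the degree d component of the equality between x and pi^n times the class of g. *)
have {}H : F (d - 1) ((pi : K) ^+ n *: g@_d - f@_d).
  have := H _ Ff d; rewrite coef_lmono0M -scalerAl mul1r; apply.
  by apply: rees_ringM => //; apply: rees_ringK.
have -> : gr_class F d f@_d = gr_class F d ((pi : K) ^+ n *: g@_d).
  by apply/esym/gr_class_eq => //; apply: alg_filtZ.
rewrite gr_classZ // scalerA mulVf ?expf_neq0 ?unif_neq0 // scale1r.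
by exists g@_d.
Qed.

Lemma ordD x y : ord L x -> ord L y -> ord L (x + y).
Proof.
move=> Lx Ly; rewrite -[y]opprK -[- y]sub0r; do 2?apply: ordB => //.
exact: ord_zero.
Qed.

(* Expanding x on elements of L and clearing denominators puts a nonzero      *)
(* multiple of x in L.                                                        *)
Lemma ord_multiple (x : A) : exists2 d : K, d != 0 & ord L (d *: x).
Proof.
have [n [e [Le [c _ <-]]]] := ord_span L x.
have [d d0 Od] := Ov_denominator v c; exists d => //.
rewrite scaler_sumr; apply: big_ind => [|y z Ly Lz|i _].
- exact: ord_zero.
- exact: ordD.
- by rewrite scalerA; apply: ordZ.
Qed.

Lemma FL_basis d : fin_gen (Ov v) (FL L F d) ->
  exists n (e : 'I_n -> A), [/\ lin_indep setT e,
    FL L F d = lincomb (Ov v) e & F d = lincomb setT e].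
Proof.
move=> /fin_gen_basis[n [e [inde FLe]]]; exists n, e; split=> //.
rewrite eqEsubset; split=> [x Fx|_ [c _ <-]].
  have [b b0 Lbx] := ord_multiple x.
  have : FL L F d (b *: x) by split=> //; apply: alg_filtZ.
  rewrite FLe => -[c _ cE]; exists (fun i => b^-1 * c i) => //.
  by under eq_bigr do rewrite -scalerA; rewrite -scaler_sumr cE scalerK.
apply: filt_sum => i _; apply: alg_filtZ.
suff [] : FL L F d (e i) by [].
by rewrite FLe; apply: lincomb_gen; [apply: Ov0 | apply: Ov1].
Qed.

Lemma good_Fv d : fin_gen (Ov v) (FL L F d) ->
  good_filtration (val_filt pi) (F d) (fun n => Fv pi L n `&` F d).
Proof.
(* All degree shifts are 0: x lies in F^v_n A exactly when pi^n x has integral coordinates. *)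
move=> /FL_basis[s [e [inde FLe Fe]]]; exists s, e, (fun=> 0); split.
  by move=> i; rewrite Fe; apply: lincomb_gen.
move=> n; rewrite subr0 eqEsubset; split=> [x [/FvE Lx Fx]|_ [c Oc <-]].
  have : FL L F d ((pi : K) ^ n *: x) by split=> //; apply: alg_filtZ.
  rewrite FLe => -[c Oc cE].
  exists (fun i => (pi : K) ^ (- n) * c i) => [i|]; first by exists (c i).
  under eq_bigr do rewrite -scalerA.
  by rewrite -scaler_sumr cE unif_expK.
split; last by rewrite Fe; exists c.
apply/FvE; suff [] : FL L F d ((pi : K) ^ n *: \sum_i c i *: e i) by [].
rewrite FLe scaler_sumr; exists (fun i => (pi : K) ^ n * c i) => [i|].
  have [a Oa <-] := Oc i.
  by rewrite mulrA -expfzDr ?unif_neq0 // addrN expr0z mul1r.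
by apply: eq_bigr => i _; rewrite scalerA.
Qed.

Lemma red_eq0 x : ord L x -> red pi L x = 0 <-> mv_ord pi L x.
Proof.
move=> Lx; have L0 := ord_zero L.
have red0 : red pi L 0 = 0.
  by apply: (addrI (red pi L 0)); rewrite -sq_classD ?addr0.
by rewrite -red0 [red _ _ x = _]sq_class_eq // subr0.
Qed.

(** A representative of a class in the induced filtration may differ from x, but its degree 0
    coefficient lies in F_n L and is congruent to x modulo F^v_{-1} A = m_v L. *)
Lemma Fbar_AvE n : Fbar_Av pi L F n = red pi L @` FL L F n.
Proof.
have Fv0E x : Fv pi L 0 x <-> ord L x by rewrite FvE expr0z scale1r.
rewrite eqEsubset; split=> _ [x [Lx Fx] <-].
  have [f Ff /rees_class_eq H] := Fx.
  have [Fnf /Fv0E Lf] := Ff 0; exists f@_0 => //.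
  apply/sq_class_eq => //; apply/mv_ordE.
  have := H _ _ 0; rewrite coef_lmono eqxx add0r; apply.
    by move=> m; have [] := Ff m.
  by apply: rees_lmono; apply/Fv0E.
exists x => //; split=> //=; exists (lmono 0 x) => // m.
rewrite coef_lmono; case: eqP => [<-|_]; first by split=> //; apply/Fv0E.
by split; apply: filt0.
Qed.

Lemma unramified_Fbar_Av n : fin_gen (Ov v) (FL L F n) ->
  unramified_reduction pi L (F n) (FL L F n) (Fbar_Av pi L F n).
Proof.
move=> fgL; split.
  by have [m [e [inde -> ->]]] := FL_basis fgL; apply: lattice_lincomb.
split=> [|x [Lx Fx]]; first exact: Fbar_AvE.
rewrite red_eq0 //; split=> [[y Ly yE]|[y [Ly _] <-]]; last by exists y.
exists y => //; split=> //.
(* Dividing by pi stays inside the K-subspace F_n A, so m_v L meets F_n A in m_v F_n L. *)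
by rewrite -[y](scalerK (unif_neq0 pi)) yE; apply: alg_filtZ.
Qed.

End OrderFiltration.

Lemma coef_sum_lmono (R : pzRingType) (d : {fset int}) (E : int -> R) n :
  (\sum_(i <- d) lmono i (E i) : laurent R)@_n = if n \in d then E n else 0.
Proof.
rewrite raddf_sum /=; case: ifPn => nd; last first.
  rewrite big_seq big1 // => i id.
  by rewrite coef_lmono; case: eqP id => // ->; rewrite (negPf nd).
rewrite (big_rem n) //= coef_lmono eqxx big_seq big1 ?addr0 // => i.
rewrite (mem_rem_uniq _ (fset_uniq d)) inE => /andP[/negPf ni _].
by rewrite coef_lmono ni.
Qed.

(** * The isomorphism of A_v[t,t^-1] with G_{F^v}(A) *)

Section GradedIsomorphism.
Variables (K : fieldType) (v : discrete_valuation K) (pi : uniformizer v).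
Variables (A : algType K) (L : Ov_order v A).
Local Notation S := (rees_ring (Fv pi L)).
Local Notation cls := (sq_class (rees_data (Fv pi L))).

(* t in degree one corresponds to pi^-1 *)
Definition laurent_lift (p : laurent (Av pi L)) : laurent A :=
  \sum_(i <- msupp p) lmono i ((pi : K) ^ (- i) *: sq_val (sq_rep p@_i)).

Definition laurent_to_gr (p : laurent (Av pi L)) : gr (Fv pi L) :=
  cls (laurent_lift p).

Lemma red_sq_val (q : Av pi L) : red pi L (sq_val (sq_rep q)) = q.
Proof.
rewrite -[RHS]sq_repK [LHS]sq_pi_sub; first exact: sq_valP.
by move=> Sq; congr sq_pi; apply: val_inj.
Qed.

Lemma red0 : red pi L 0 = 0.
Proof. exact/red_eq0/mv_ord0/ord_zero. Qed.

Lemma redD x y : ord L x -> ord L y -> red pi L (x + y) = red pi L x + red pi L y.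
Proof. exact: (@sq_classD _ (Av_data pi L)). Qed.

Lemma redM x y : ord L x -> ord L y -> red pi L (x * y) = red pi L x * red pi L y.
Proof. exact: (@sq_classM _ (Av_data pi L)). Qed.

Lemma rees_FvE f : S f <-> forall n, ord L ((pi : K) ^ n *: f@_n).
Proof. by split=> H n; apply/FvE; apply: H. Qed.

Lemma laurent_lift_coef p n :
  ord L ((pi : K) ^ n *: (laurent_lift p)@_n) /\
  red pi L ((pi : K) ^ n *: (laurent_lift p)@_n) = p@_n.
Proof.
rewrite coef_sum_lmono; case: (msuppP p n) => [pn|pn].
  by rewrite unif_expVK red_sq_val; split=> //; apply: sq_valP.
by rewrite scaler0 red0; split=> //; apply: ord_zero.
Qed.

Lemma laurent_lift_rees p : S (laurent_lift p).
Proof. by apply/rees_FvE => n; have [] := laurent_lift_coef p n. Qed.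

(** This coefficientwise criterion allows any Rees representative in place of the chosen lift;
    additivity, multiplicativity and bijectivity are all checked through it. *)
Lemma laurent_to_grE p f : S f ->
  laurent_to_gr p = cls f <-> forall n, red pi L ((pi : K) ^ n *: f@_n) = p@_n.
Proof.
move=> Sf; rewrite rees_class_eq //; last exact: laurent_lift_rees.
suff E n : Fv pi L (n - 1) ((laurent_lift p)@_n - f@_n) <->
    red pi L ((pi : K) ^ n *: f@_n) = p@_n.
  by split=> H n; apply/E.
have [Lp <-] := laurent_lift_coef p n; have Lf := (rees_FvE f).1 Sf n.
(* Splitting pi^(n-1) as pi^-1 pi^n turns membership in F^v_{n-1} A into membership of the rescaled
   difference in m_v L. *)
rewrite FvE addrC expfzDr ?unif_neq0 // -scalerA -FvE scalerBr.
rewrite -mv_ordE; have [redE Ered] := sq_class_eq (D := Av_data pi L) Lp Lf.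
by split=> [/Ered|/esym/redE].
Qed.

Lemma laurent_to_gr_lift p : exists f, [/\ S f, laurent_to_gr p = cls f &
  forall n, red pi L ((pi : K) ^ n *: f@_n) = p@_n].
Proof.
exists (laurent_lift p); have Sp := laurent_lift_rees p.
by split=> //; apply/laurent_to_grE.
Qed.

Lemma gr_laurent f : S f -> exists p, laurent_to_gr p = cls f.
Proof.
move=> Sf.
exists (\sum_(i <- msupp f) lmono i (red pi L ((pi : K) ^ i *: f@_i))).
apply/laurent_to_grE => // n; rewrite coef_sum_lmono.
by case: (msuppP f n) => // fn; rewrite scaler0 red0.
Qed.

Lemma laurent_to_gr_zmod : zmod_morphism laurent_to_gr.
Proof.
suff D : {morph laurent_to_gr : p q / p + q}.
  by move=> p q; apply/eqP; rewrite eq_sym subr_eq -D subrK.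
move=> p q; have [f [Sf -> fp]] := laurent_to_gr_lift p.
have [g [Sg -> gq]] := laurent_to_gr_lift q.
rewrite -sq_classD //; apply/laurent_to_grE => [n|n].
  by rewrite mcoeffD; apply: filtD.
rewrite !mcoeffD scalerDr -fp -gq.
by rewrite redD //; [apply: (rees_FvE f).1 | apply: (rees_FvE g).1].
Qed.

Lemma red_sum (I : Type) (r : seq I) (E : I -> A) :
  (forall i, ord L (E i)) ->
  red pi L (\sum_(i <- r) E i) = \sum_(i <- r) red pi L (E i).
Proof.
move=> LE; suff [] : ord L (\sum_(i <- r) E i) /\
  red pi L (\sum_(i <- r) E i) = \sum_(i <- r) red pi L (E i) by [].
elim: r => [|i r [Lr IHr]].
  by rewrite !big_nil red0; split=> //; apply: ord_zero.
rewrite !big_cons; split; first exact: ordD.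
by rewrite -IHr redD.
Qed.

Lemma laurent_to_gr_monoid : monoid_morphism laurent_to_gr.
Proof.
split=> [|p q].
  rewrite -[RHS]sq_class1; apply/laurent_to_grE => [|n]; first exact: rees_ring1.
  rewrite !coef_lmono; case: eqP => [<-|_]; last by rewrite scaler0 red0.
  by rewrite expr0z scale1r [LHS]sq_class1.
have [f [Sf -> fp]] := laurent_to_gr_lift p.
have [g [Sg -> gq]] := laurent_to_gr_lift q.
have Lf := (rees_FvE f).1 Sf; have Lg := (rees_FvE g).1 Sg.
(* Reduction may kill coefficients, so p and q are expanded over the larger supports of f and g to
   match the two double sums. *)
have supp (h : laurent A) r : (forall n, red pi L ((pi : K) ^ n *: h@_n) = r@_n) ->
    (msupp r `<=` msupp h)%fset.
  move=> hr; apply/fsubsetP => n; apply: contraLR => /mcoeff_outdom hn.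
  by rewrite -mcoeff_eq0 -hr hn scaler0 red0.
rewrite -[RHS]sq_classM //; apply/laurent_to_grE => [|n]; first exact: rees_ringM.
rewrite [p * q](lmulw (supp _ _ fp) (supp _ _ gq)) laurent_mulE !raddf_sum.
have LE i j : ord L ((pi : K) ^ n *: (lmono (i + j) (f@_i * g@_j))@_n).
  rewrite coef_lmono; case: eqP => [<-|_]; last by rewrite scaler0; apply: ord_zero.
  (* In degree i + j the power of pi is shared out as (pi^i f_i)(pi^j g_j), a product of two
     elements of L. *)
  by rewrite expfzDr ?unif_neq0 // -scalerA scalerAr scalerAl; apply: ordM.
under eq_bigr do rewrite !raddf_sum /=.
rewrite red_sum => [|i]; last first.
  by apply: (big_ind (ord L)); [apply: ord_zero | apply: ordD |].
apply: eq_bigr => i _; rewrite red_sum // raddf_sum; apply: eq_bigr => j _ /=.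
rewrite !coef_lmono; case: eqP => [<-|_]; last by rewrite scaler0 red0.
rewrite expfzDr ?unif_neq0 // -scalerA scalerAr scalerAl -fp -gq.
exact: redM.
Qed.

HB.instance Definition _ :=
  GRing.isZmodMorphism.Build _ _ laurent_to_gr laurent_to_gr_zmod.
HB.instance Definition _ :=
  GRing.isMonoidMorphism.Build _ _ laurent_to_gr laurent_to_gr_monoid.

Lemma laurent_to_gr_inj : injective laurent_to_gr.
Proof.
move=> p q; have [f [Sf -> fp]] := laurent_to_gr_lift p.
by move/esym/laurent_to_grE => /(_ Sf) fq; apply/malgP => n; rewrite -fp fq.
Qed.

Lemma laurent_to_gr_bij : bijective laurent_to_gr.
Proof.
have [h hK] : {h & forall y, laurent_to_gr (h y) = y}.
  apply: (choice (P := fun y p => laurent_to_gr p = y)) => y.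
  by have [f Sf ->] := sq_class_surj y; apply: gr_laurent.
exists h => // p; apply: laurent_to_gr_inj; exact: hK.
Qed.

Lemma laurent_to_gr_lmono n x : ord L x ->
  laurent_to_gr (lmono n (red pi L x)) =
  gr_class (Fv pi L) n ((pi : K) ^ (- n) *: x).
Proof.
move=> Lx; apply/laurent_to_grE => [|m].
  by apply: rees_lmono; apply/FvE; rewrite unif_expVK.
rewrite !coef_lmono; case: eqP => [<-|_]; first by rewrite unif_expVK.
by rewrite scaler0 red0.
Qed.

Lemma laurent_to_gr_deg n :
  laurent_to_gr @` range (@lmono (Av pi L) n) = gr_deg (Fv pi L) n.
Proof.
rewrite eqEsubset; split=> [_ [_ [q _ <-] <-]|_ [_ [x Lx <-] <-]].
  have [x Lx ->] := sq_class_surj q.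
  rewrite [X in gr_deg _ _ X]laurent_to_gr_lmono //.
  by exists ((pi : K) ^ (- n) *: x) => //; exists x.
exists (lmono n (red pi L x)); first by exists (red pi L x).
exact: laurent_to_gr_lmono.
Qed.

Lemma laurent_to_gr_Fbar (F : alg_filtration A) n :
  Fbar pi L F n = laurent_to_gr @` [set p | forall j, Fbar_Av pi L F n p@_j].
Proof.
rewrite Fbar_AvE eqEsubset; split=> [_ [f Ff <-]|_ [p Fp <-]].
  have Sf : S f by move=> j; have [] := Ff j.
  have [p pf] := gr_laurent Sf; exists p => // j.
  have /(laurent_to_grE p Sf) <- := pf.
  exists ((pi : K) ^ j *: f@_j) => //; split; first by move/rees_FvE: Sf.
  by apply: alg_filtZ; have [] := Ff j.
(* Representatives taken in F_n L, not merely in L, make the lift lie in F_n A in each degree;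
   summing over the support of p keeps it finite. *)
have [x xE] : {x & forall j, FL L F n (x j) /\ red pi L (x j) = p@_j}.
  apply: (choice (P := fun j y => FL L F n y /\ red pi L y = p@_j)) => j.
  by have [y ? ?] := Fp j; exists y.
pose f : laurent A := \sum_(j <- msupp p) lmono j ((pi : K) ^ (- j) *: x j).
have fE j : f@_j = if j \in msupp p then (pi : K) ^ (- j) *: x j else 0.
  exact: coef_sum_lmono.
have Ff j : (F n `&` Fv pi L j) f@_j.
  have [[Lx Fx] _] := xE j; rewrite fE; case: ifP => _; last by split; apply: filt0.
  by split; [apply: alg_filtZ | apply/FvE; rewrite unif_expVK].
exists f => //; apply/esym/laurent_to_grE => [j|j]; first by have [] := Ff j.
rewrite fE; case: (msuppP p j) => _; last by rewrite scaler0 red0.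
by rewrite unif_expVK (xE j).2.
Qed.

End GradedIsomorphism.

Theorem theorem2p6 (K : fieldType) (v : discrete_valuation K)
    (pi : uniformizer v) (A : algType K) (F : alg_filtration A)
    (L : Ov_order v A) (exhF : exhaustive F) (sepF : separated F) :
  (GA_finite L F -> separated (Fv pi L)) /\
  (FA_finite L F ->
    [/\ separated (fvG pi L F),
        separated (Fv pi L),
        (forall n : int,
          unramified_reduction pi L (F n) (FL L F n) (Fbar_Av pi L F n)),
        (exists theta : {rmorphism laurent (Av pi L) -> gr (Fv pi L)},
          [/\ bijective theta,
              (forall x : A, ord L x ->
                theta (lmono 0 (red pi L x)) = gr_class (Fv pi L) 0 x),
              (forall n : int,
                theta @` range (@lmono (Av pi L) n) = gr_deg (Fv pi L) n) &
              (forall n : int,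
                Fbar pi L F n =
                theta @` [set p | forall j : int, Fbar_Av pi L F n p@_j])]) &
        (forall d : int,
          good_filtration (val_filt pi) (F d) (fun n => Fv pi L n `&` F d))]).
Proof.
split=> [|FAfin]; first exact: separated_Fv.
have GAfin := FA_finite_GA_finite FAfin; split.
- exact: separated_fvG.
- exact: separated_Fv GAfin.
- by move=> n; apply: unramified_Fbar_Av.
- exists (@laurent_to_gr _ _ pi _ L : {rmorphism _ -> _}); split.
  + exact: laurent_to_gr_bij.
  + move=> x Lx; apply: etrans (laurent_to_gr_lmono pi 0 Lx) _.
    by rewrite oppr0 expr0z scale1r.
  + exact: laurent_to_gr_deg.
  + exact: laurent_to_gr_Fbar.
- by move=> d; apply: good_Fv.
Qed.
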